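(* Let $(D,\dashv,\vdash,\theta_\dashv,\theta_\vdash)$ be a diassociative bialgebra, $(B,\diamond,\varpi)$ a quadratic Zinbiel algebra, and $(D\otimes B,\cdot,\Delta)$ the induced ASI bialgebra, i.e. $(d_1\otimes b_1)\cdot(d_2\otimes b_2)=(d_1\vdash d_2)\otimes(b_1\diamond b_2)+(d_1\dashv d_2)\otimes(b_2\diamond b_1)$ and $\Delta(d\otimes b)=\theta_\vdash(d)\bullet\nu_\varpi(b)+\theta_\dashv(d)\bullet\tau(\nu_\varpi(b))$. Suppose $r=\sum_i x_i\otimes y_i\in D\otimes D$ is a symmetric solution of the diassociative Yang-Baxter equation in $(D,\dashv,\vdash)$ and $\theta_\dashv=\theta_{\dashv,r}$, $\theta_\vdash=\theta_{\vdash,r}$. Let $\{e_j\}$ be a basis of $B$, $\{f_j\}$ its dual basis with respect to $\varpi$ (i.e. $\varpi(f_i,e_j)=\delta_{ij}$), and $\widetilde r=\sum_{i,j}(x_i\otimes e_j)\otimes(y_i\otimes f_j)$. Then $(D\otimes B,\cdot,\Delta)=(D\otimes B,\cdot,\Delta_{\widetilde r})$ as ASI bialgebras, where $$\Delta_{\widetilde r}(a)=(\mathrm{id}\otimes\mathbf l_{D\otimes B}(a)-\mathbf r_{D\otimes B}(a)\otimes\mathrm{id})(\widetilde r),\qquad a\in D\otimes B.$$ That is, the induced ASI bialgebra $(D\otimes B,\cdot,\Delta)$ is triangular if $(D,\dashv,\vdash,\theta_\dashv,\theta_\vdash)$ is triangular.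
   Context: All vector spaces are finite-dimensional over a field $\Bbbk$ of characteristic zero; $\tau(x\otimes y)=y\otimes x$; $(d'\otimes d'')\bullet(b'\otimes b''):=(d'\otimes b')\otimes(d''\otimes b'')$, extended bilinearly. Diassociative algebra $(D,\dashv,\vdash)$: two associative bilinear products on $D$ with $(d_1\dashv d_2)\dashv d_3=d_1\dashv(d_2\vdash d_3)$, $(d_1\vdash d_2)\dashv d_3=d_1\vdash(d_2\dashv d_3)$, $(d_1\dashv d_2)\vdash d_3=(d_1\vdash d_2)\vdash d_3$. Write $\mathbf l_{\dashv}(d)(x)=d\dashv x$, $\mathbf r_{\dashv}(d)(x)=x\dashv d$, $\mathbf l_{\vdash}(d)(x)=d\vdash x$, $\mathbf r_{\vdash}(d)(x)=x\vdash d$. Diassociative coalgebra $(D,\theta_\dashv,\theta_\vdash)$: $\theta_\dashv,\theta_\vdash:D\to D\otimes D$ coassociative with $(\theta_\dashv\otimes\mathrm{id})\theta_\dashv=(\mathrm{id}\otimes\theta_\vdash)\theta_\dashv$, $(\theta_\vdash\otimes\mathrm{id})\theta_\dashv=(\mathrm{id}\otimes\theta_\dashv)\theta_\vdash$, $(\theta_\dashv\otimes\mathrm{id})\theta_\vdash=(\theta_\vdash\otimes\mathrm{id})\theta_\vdash$. Diassociative bialgebra: both structures on $D$ such that for all $d_1,d_2\in D$: (1) $(\mathrm{id}\otimes\mathbf l_\dashv(d_1))\theta_\dashv(d_2)=(\mathbf r_\vdash(d_2)\otimes\mathrm{id})\theta_\vdash(d_1)$; (2) $(\mathbf l_\dashv(d_1)\otimes\mathrm{id})\theta_\vdash(d_2)=(\mathrm{id}\otimes\mathbf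 l_\dashv(d_2))\tau\theta_\vdash(d_1)$; (3) $(\mathbf r_\vdash(d_1)\otimes\mathrm{id})\tau\theta_\dashv(d_2)=(\mathrm{id}\otimes\mathbf r_\vdash(d_2))\theta_\dashv(d_1)$; (4) $\theta_\vdash(d_1\vdash d_2)=(\mathrm{id}\otimes\mathbf l_\vdash(d_1))\theta_\vdash(d_2)-((\mathbf r_\vdash-\mathbf r_\dashv)(d_2)\otimes\mathrm{id})(\theta_\vdash-\theta_\dashv)(d_1)$; (5) $\theta_\vdash(d_1\dashv d_2)=(\mathrm{id}\otimes\mathbf l_\dashv(d_1))(\theta_\vdash-\theta_\dashv)(d_2)+(\mathbf r_\dashv(d_2)\otimes\mathrm{id})\theta_\vdash(d_1)$; (6) $\theta_\dashv(d_1\vdash d_2)=(\mathrm{id}\otimes(\mathbf l_\vdash-\mathbf l_\dashv)(d_1))\theta_\dashv(d_2)+(\mathbf r_\vdash(d_2)\otimes\mathrm{id})\theta_\dashv(d_1)$; (7) $\theta_\dashv(d_1\dashv d_2)=(\mathbf r_\dashv(d_2)\otimes\mathrm{id})\theta_\dashv(d_1)-(\mathrm{id}\otimes(\mathbf l_\vdash-\mathbf l_\dashv)(d_1))(\theta_\vdash-\theta_\dashv)(d_2)$; (8) $((\mathbf l_\vdash-\mathbf l_\dashv)(d_1)\otimes\mathrm{id})\theta_\vdash(d_2)+(\mathrm{id}\otimes\mathbf l_\dashv(d_2))\tau\theta_\dashv(d_1)=((\mathbf r_\vdash-\mathbf r_\dashv)(d_2)\otimes\mathrm{id})\tau(\theta_\vdash-\theta_\dashv)(d_1)+(\mathrm{id}\otimes\mathbf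 r_\dashv(d_1))\theta_\vdash(d_2)$; (9) $(\mathbf r_\dashv(d_1)\otimes\mathrm{id})\tau\theta_\dashv(d_2)+(\mathrm{id}\otimes\mathbf r_\vdash(d_2))(\theta_\vdash-\theta_\dashv)(d_1)=((\mathbf l_\vdash-\mathbf l_\dashv)(d_2)\otimes\mathrm{id})(\theta_\vdash-\theta_\dashv)(d_1)+(\mathrm{id}\otimes\mathbf l_\vdash(d_1))\tau\theta_\dashv(d_2)$. The diassociative Yang-Baxter equation for $r=\sum_i x_i\otimes y_i\in D\otimes D$ is $\sum_{i,j}\big(x_i\otimes x_j\otimes(y_i\vdash y_j)-x_j\otimes(x_i\dashv y_j)\otimes y_i-(x_i\vdash x_j)\otimes y_i\otimes y_j+(x_i\dashv x_j)\otimes y_i\otimes y_j\big)=0$; $r$ is symmetric if $\tau(r)=r$. Set $\theta_{\dashv,r}(d)=\big(\mathrm{id}\otimes(\mathbf l_\vdash-\mathbf l_\dashv)(d)-\mathbf r_\vdash(d)\otimes\mathrm{id}\big)(r)$ and $\theta_{\vdash,r}(d)=-\big((\mathbf r_\vdash-\mathbf r_\dashv)(d)\otimes\mathrm{id}+\mathrm{id}\otimes\mathbf l_\dashv(d)\big)(r)$. A diassociative bialgebra is triangular if $\theta_\dashv=\theta_{\dashv,r}$, $\theta_\vdash=\theta_{\vdash,r}$ for some symmetric solution $r$. Zinbiel algebra $(B,\diamond)$: $b_1\diamond(b_2\diamond b_3)=(b_1\diamond b_2)\diamond b_3+(b_2\diamond b_1)\diamond b_3$. Quadratic Zinbiel algebra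 $(B,\diamond,\varpi)$: with a nondegenerate skew-symmetric bilinear form $\varpi$ with $\varpi(b_1\diamond b_2,b_3)=\varpi(b_2,b_1\diamond b_3+b_3\diamond b_1)$. The map $\nu_\varpi:B\to B\otimes B$ is defined by $\varpi(\nu_\varpi(b_1),b_2\otimes b_3)=\varpi(b_1,b_2\diamond b_3)$, where $\varpi(a\otimes b,a'\otimes b')=\varpi(a,a')\varpi(b,b')$. ASI bialgebra $(A,\cdot,\Delta)$: $(A,\cdot)$ associative, $\Delta:A\to A\otimes A$ coassociative, and with $\mathbf l_A(a)(x)=a\cdot x$, $\mathbf r_A(a)(x)=x\cdot a$: $\Delta(a_1\cdot a_2)=(\mathbf r_A(a_2)\otimes\mathrm{id})\Delta(a_1)+(\mathrm{id}\otimes\mathbf l_A(a_1))\Delta(a_2)$ and $(\mathbf l_A(a_1)\otimes\mathrm{id}-\mathrm{id}\otimes\mathbf r_A(a_1))\Delta(a_2)=\tau\big((\mathrm{id}\otimes\mathbf r_A(a_2)-\mathbf l_A(a_2)\otimes\mathrm{id})\Delta(a_1)\big)$. It is triangular if there is $s=\sum_i u_i\otimes v_i$ with $\tau(s)=-s$, $\sum_{i,j}\big((u_i\cdot u_j)\otimes v_i\otimes v_j+u_i\otimes u_j\otimes(v_i\cdot v_j)-u_j\otimes(u_i\cdot v_j)\otimes v_i\big)=0$, and $\Delta(a)=(\mathrm{id}\otimes\mathbf l_A(a)-\mathbf r_A(a)\otimes\mathrm{id})(s)$. *)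

(* Defs.v *)
From HB Require Import structures.
From mathcomp Require Import all_boot all_order all_algebra.

Set Implicit Arguments.
Unset Strict Implicit.
Unset Printing Implicit Defensive.

Import GRing.Theory.
Import VectorInternalTheory.
Local Open Scope ring_scope.

Notation bilinear_map f := (bilinear_for *:%R *:%R f).
Notation bilinear_form f := (bilinear_for *%R *%R f).

(* The tensor product of two finite-dimensional spaces is realised as the space
   of coordinate matrices in the canonical bases; [tens_bilinear], [tlift_tens],
   [tlift_linear] and [tens_ext] are its universal property. *)

Definition tensor (k : fieldType) (U V : vectType k) : Type :=
  'M[k]_(dim U, dim V).

HB.instance Definition _ (k : fieldType) (U V : vectType k) :=
  Vector.copy (tensor U V) 'M[k]_(dim U, dim V).

Definition tens (k : fieldType) (U V : vectType k) (u : U) (v : V) :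
  tensor U V := (v2r u)^T *m v2r v.

Notation "u *t v" := (tens u v)
  (at level 38, right associativity) : ring_scope.

Definition tlift (k : fieldType) (U V : vectType k) (W : lmodType k)
    (f : U -> V -> W) (t : tensor U V) : W :=
  \sum_(i < dim U) \sum_(j < dim V)
     (t : 'M_(_, _)) i j *: f (r2v (delta_mx 0 i)) (r2v (delta_mx 0 j)).

Section TensorTheory.
Variables (k : fieldType) (U V : vectType k) (W : lmodType k).

Lemma tens_bilinear : bilinear_map (@tens k U V).
Proof.
split=> [v|u] a x y; apply/matrixP=> i j; rewrite !mxE !big_ord1 !mxE.
  by rewrite linearP !mxE mulrDl mulrA.
by rewrite linearP !mxE mulrDr mulrCA.
Qed.

Lemma tlift_linear (f : U -> V -> W) : linear (tlift f).
Proof.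
move=> a s t; rewrite /tlift scaler_sumr -big_split; apply: eq_bigr => i _ /=.
rewrite scaler_sumr -big_split; apply: eq_bigr => j _ /=.
by rewrite !mxE scalerDl scalerA.
Qed.

Lemma linear_comb (X Y : lmodType k) (g : X -> Y) (I : Type) (r : seq I)
    (c : I -> k) (x : I -> X) : linear g ->
  g (\sum_(i <- r) c i *: x i) = \sum_(i <- r) c i *: g (x i).
Proof.
move=> lg; pose G := GRing.isLinear.Build _ _ _ _ g lg.
pose g' : {linear X -> Y} := HB.pack g G.
rewrite -[g]/(g' : _ -> _) linear_sum.
by apply: eq_bigr => i _; rewrite linearZ.
Qed.

Lemma vect_decomp (X : vectType k) (u : X) :
  u = \sum_i v2r u 0 i *: r2v (delta_mx 0 i).
Proof.
rewrite -{1}(v2rK u) {1}(row_sum_delta (v2r u)) linear_sum.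
by apply: eq_bigr => i _; rewrite linearZ.
Qed.

Lemma tlift_tens (f : U -> V -> W) (u : U) (v : V) :
  bilinear_map f -> tlift f (u *t v) = f u v.
Proof.
move=> [fl fr]; rewrite [in RHS](vect_decomp u).
rewrite (linear_comb (g := f^~ v)) //; apply: eq_bigr => i _.
rewrite [in RHS](vect_decomp v) (linear_comb (g := f _)) // scaler_sumr.
by apply: eq_bigr => j _; rewrite scalerA /tens mxE big_ord1 !mxE.
Qed.

Lemma tens_decomp (t : tensor U V) :
  t = \sum_i \sum_j (t : 'M_(_, _)) i j *:
        (r2v (delta_mx 0 i) *t r2v (delta_mx 0 j)).
Proof.
rewrite [LHS]matrix_sum_delta; apply: eq_bigr => i _; apply: eq_bigr => j _.
congr (_ *: _); rewrite /tens !r2vK; apply/matrixP=> a b.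
by rewrite !mxE big_ord1 !mxE /= -natrM mulnb.
Qed.

Lemma tens_ext (f g : tensor U V -> W) : linear f -> linear g ->
  (forall u v, f (u *t v) = g (u *t v)) -> f =1 g.
Proof.
move=> lf lg fg t.
pose F := GRing.isLinear.Build _ _ _ _ f lf.
pose G := GRing.isLinear.Build _ _ _ _ g lg.
pose f' : {linear tensor U V -> W} := HB.pack f F.
pose g' : {linear tensor U V -> W} := HB.pack g G.
rewrite -[f]/(f' : _ -> _) -[g]/(g' : _ -> _) (tens_decomp t) !linear_sum.
apply: eq_bigr => i _; rewrite !linear_sum; apply: eq_bigr => j _.
by rewrite !linearZ /= fg.
Qed.

End TensorTheory.

Section TensorMaps.
Variable k : fieldType.
Implicit Types U V W X : vectType k.

Definition tmap U V W X (f : U -> W) (g : V -> X) : tensor U V -> tensor W X :=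
  tlift (fun u v => f u *t g v).

Definition tau U V : tensor U V -> tensor V U := tlift (fun u v => v *t u).

Definition tassoc U V W : tensor (tensor U V) W -> tensor U (tensor V W) :=
  tlift (fun s w => tlift (fun u v => u *t v *t w) s).

Definition bullet U V W X (s : tensor U V) (t : tensor W X) :
    tensor (tensor U W) (tensor V X) :=
  tlift (fun u v => tlift (fun w x => (u *t w) *t (v *t x)) t) s.

Definition lmul U (m : U -> U -> U) (a : U) : U -> U := fun x => m a x.
Definition rmul U (m : U -> U -> U) (a : U) : U -> U := fun x => m x a.

Definition coassociative U (th : U -> tensor U U) : Prop :=
  forall a, tassoc (tmap th id (th a)) = tmap id th (th a).

End TensorMaps.

Section Diassociative.
Variables (k : fieldType) (D : vectType k).
(* [da] is the product written with \dashv, [vd] the one written with \vdash. *)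
Variables (da vd : D -> D -> D) (th_da th_vd : D -> tensor D D).

Record diass_algebra : Prop := DiassAlgebra {
  da_bilinear : bilinear_map da;
  vd_bilinear : bilinear_map vd;
  da_assoc : associative da;
  vd_assoc : associative vd;
  da_da_vd : forall x y z, da (da x y) z = da x (vd y z);
  vd_da_mixed : forall x y z, da (vd x y) z = vd x (da y z);
  da_vd_vd : forall x y z, vd (da x y) z = vd (vd x y) z }.

Record diass_coalgebra : Prop := DiassCoalgebra {
  th_da_linear : linear th_da;
  th_vd_linear : linear th_vd;
  th_da_coassoc : coassociative th_da;
  th_vd_coassoc : coassociative th_vd;
  th_da_da_vd : forall d,
    tassoc (tmap th_da id (th_da d)) = tmap id th_vd (th_da d);
  th_vd_da_mixed : forall d,
    tassoc (tmap th_vd id (th_da d)) = tmap id th_da (th_vd d);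
  th_da_vd_vd : forall d,
    tassoc (tmap th_da id (th_vd d)) = tassoc (tmap th_vd id (th_vd d)) }.

Local Notation l_da := (lmul da).
Local Notation r_da := (rmul da).
Local Notation l_vd := (lmul vd).
Local Notation r_vd := (rmul vd).

Record diass_bialgebra : Prop := DiassBialgebra {
  diass_bialgebra_alg : diass_algebra;
  diass_bialgebra_coalg : diass_coalgebra;
  diass_bialgebra1 : forall d1 d2,
    tmap id (l_da d1) (th_da d2) = tmap (r_vd d2) id (th_vd d1);
  diass_bialgebra2 : forall d1 d2,
    tmap (l_da d1) id (th_vd d2) = tmap id (l_da d2) (tau (th_vd d1));
  diass_bialgebra3 : forall d1 d2,
    tmap (r_vd d1) id (tau (th_da d2)) = tmap id (r_vd d2) (th_da d1);
  diass_bialgebra4 : forall d1 d2,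
    th_vd (vd d1 d2) =
      tmap id (l_vd d1) (th_vd d2)
      - tmap (r_vd d2 \- r_da d2) id (th_vd d1 - th_da d1);
  diass_bialgebra5 : forall d1 d2,
    th_vd (da d1 d2) =
      tmap id (l_da d1) (th_vd d2 - th_da d2) + tmap (r_da d2) id (th_vd d1);
  diass_bialgebra6 : forall d1 d2,
    th_da (vd d1 d2) =
      tmap id (l_vd d1 \- l_da d1) (th_da d2) + tmap (r_vd d2) id (th_da d1);
  diass_bialgebra7 : forall d1 d2,
    th_da (da d1 d2) =
      tmap (r_da d2) id (th_da d1)
      - tmap id (l_vd d1 \- l_da d1) (th_vd d2 - th_da d2);
  diass_bialgebra8 : forall d1 d2,
    tmap (l_vd d1 \- l_da d1) id (th_vd d2)
      + tmap id (l_da d2) (tau (th_da d1)) =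
    tmap (r_vd d2 \- r_da d2) id (tau (th_vd d1 - th_da d1))
      + tmap id (r_da d1) (th_vd d2);
  diass_bialgebra9 : forall d1 d2,
    tmap (r_da d1) id (tau (th_da d2))
      + tmap id (r_vd d2) (th_vd d1 - th_da d1) =
    tmap (l_vd d2 \- l_da d2) id (th_vd d1 - th_da d1)
      + tmap id (l_vd d1) (tau (th_da d2)) }.

Definition diass_YBE (I : finType) (x y : I -> D) : Prop :=
  \sum_i \sum_j
     (x i *t x j *t vd (y i) (y j) - x j *t da (x i) (y j) *t y i
      - vd (x i) (x j) *t y i *t y j + da (x i) (x j) *t y i *t y j) = 0.

Definition th_da_of (r : tensor D D) (d : D) : tensor D D :=
  tmap id (l_vd d \- l_da d) r - tmap (r_vd d) id r.

Definition th_vd_of (r : tensor D D) (d : D) : tensor D D :=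
  - (tmap (r_vd d \- r_da d) id r + tmap id (l_da d) r).

End Diassociative.

Definition triangular_diass (k : fieldType) (D : vectType k)
    (da vd : D -> D -> D) (th_da th_vd : D -> tensor D D) : Prop :=
  diass_bialgebra da vd th_da th_vd /\
  exists (I : finType) (x y : I -> D),
    let r := \sum_i x i *t y i in
    [/\ tau r = r, diass_YBE da vd x y,
        th_da =1 th_da_of da vd r & th_vd =1 th_vd_of da vd r].

Section QuadraticZinbiel.
Variables (k : fieldType) (B : vectType k).
Variables (dm : B -> B -> B) (om : B -> B -> k).

Record zinbiel_algebra : Prop := ZinbielAlgebra {
  zinbiel_bilinear : bilinear_map dm;
  zinbiel_id : forall a b c, dm a (dm b c) = dm (dm a b) c + dm (dm b a) c }.

Record quadratic_zinbiel : Prop := QuadraticZinbiel {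
  quadratic_zinbiel_alg : zinbiel_algebra;
  om_bilinear : bilinear_form om;
  om_skew : forall a b, om a b = - om b a;
  om_nondeg : forall a, (forall b, om a b = 0) -> a = 0;
  om_invariant : forall a b c, om (dm a b) c = om b (dm a c + dm c a) }.

Definition om2 (s t : tensor B B) : k :=
  tlift (fun a b : B =>
    (tlift (fun a' b' : B => (om a a' * om b b' : k^o)) t : k^o)) s.

(* [nu_spec] determines nu uniquely when [om] is nondegenerate:
   see [nu_exists] and [nu_unique]. *)
Definition nu_spec (nu : B -> tensor B B) : Prop :=
  forall b1 b2 b3, om2 (nu b1) (b2 *t b3) = om b1 (dm b2 b3).

End QuadraticZinbiel.

Section NuTheory.
Variables (k : fieldType) (B : vectType k).
Variables (dm : B -> B -> B) (om : B -> B -> k).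
Hypothesis hB : quadratic_zinbiel dm om.

Let bb (i : 'I_(dim B)) : B := r2v (delta_mx 0 i).
Let G : 'M[k]_(dim B) := \matrix_(i, j) om (bb i) (bb j).

Let G_unit : G \in unitmx.
Proof.
rewrite -row_free_unit -kermx_eq0; apply/rowV0P => u /sub_kermxP uG.
have [oml omr] := om_bilinear hB.
have uGj j : \sum_i u 0 i * om (bb i) (bb j) = 0.
  have := congr1 (fun M : 'rV_(dim B) => M 0 j) uG; rewrite !mxE.
  by apply: etrans; apply: eq_bigr => i _; rewrite mxE.
suff: r2v u = 0 :> B by move/(congr1 v2r); rewrite r2vK linear0.
apply: (om_nondeg hB) => b; rewrite (vect_decomp b).
rewrite (linear_comb (Y := k^o) (g := om (r2v u))) //.
apply: big1 => j _; rewrite (vect_decomp (r2v u)).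
rewrite (linear_comb (Y := k^o) (g := om^~ _)) // r2vK.
by apply: etrans (congr1 (fun z : k^o => v2r b 0 j *: z) (uGj j)) (scaler0 _ _).
Qed.

Let om2E (s : tensor B B) i j :
  om2 om s (bb i *t bb j) = (G^T *m (s : 'M_(_, _)) *m G) i j.
Proof.
have [oml omr] := om_bilinear hB.
have T u v : tlift (W := k^o) (fun a b : B => om u a * om v b) (bb i *t bb j) =
    om u (bb i) * om v (bb j).
  apply: tlift_tens; split=> [y|x] c z w; rewrite omr.
    by rewrite mulrDl -mulrA.
  by rewrite mulrDr mulrCA.
rewrite mxE; under [RHS]eq_bigr => b _ do rewrite mxE mulr_suml.
rewrite exchange_big; apply: eq_bigr => a _; apply: eq_bigr => b _.
apply: etrans (congr1 (fun z : k^o => (s : 'M_(_, _)) a b *: z) (T _ _)) _.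
rewrite /GRing.scale /= !mxE -/(bb a) -/(bb b).
by rewrite mulrA; congr (_ * _); rewrite mulrC.
Qed.

Let om2_inj (s t : tensor B B) :
  (forall b c, om2 om s (b *t c) = om2 om t (b *t c)) -> s = t.
Proof.
move=> st; have: G^T *m (s : 'M_(_, _)) *m G = G^T *m (t : 'M_(_, _)) *m G.
  by apply/matrixP=> i j; rewrite -!om2E st.
have GTu : G^T \in unitmx by rewrite unitmx_tr.
by move/(can_inj (mulmxK G_unit))/(can_inj (mulKmx GTu)).
Qed.

Lemma nu_unique nu nu' : nu_spec dm om nu -> nu_spec dm om nu' -> nu =1 nu'.
Proof. by move=> h h' b; apply: om2_inj => c d; rewrite h h'. Qed.

Lemma nu_exists : exists nu, nu_spec dm om nu.
Proof.
pose N b : 'M[k]_(dim B) := \matrix_(i, j) om b (dm (bb i) (bb j)).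
exists (fun b => invmx G^T *m N b *m invmx G : tensor B B) => b b2 b3.
set s : tensor B B := (X in om2 _ X).
have GTu : G^T \in unitmx by rewrite unitmx_tr.
have NE i j : om2 om s (bb i *t bb j) = om b (dm (bb i) (bb j)).
  by rewrite om2E /s mulmxA mulKVmx // mulmxKV // mxE.
have [oml omr] := om_bilinear hB.
have [dml dmr] := zinbiel_bilinear (quadratic_zinbiel_alg hB).
have om2lin : linear (om2 om s : tensor B B -> k^o).
  move=> c t t'; rewrite /om2 /tlift scaler_sumr -big_split.
  apply: eq_bigr => i _ /=; rewrite scaler_sumr -big_split.
  apply: eq_bigr => j _ /=.
  have L := tlift_linear (W := k^o) (fun a' b' => om (bb i) a' * om (bb j) b')
              c t t'.
  apply: etrans (congr1 (fun z : k^o => (s : 'M_(_, _)) i j *: z) L) _.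
  by rewrite scalerDr !scalerA [_ * c]mulrC.
have [tl tr] := @tens_bilinear k B B.
rewrite (vect_decomp b2) (linear_comb (g := (@tens k B B)^~ b3)) //.
rewrite (linear_comb (Y := k^o) (g := om2 om s)) //.
rewrite (linear_comb (g := dm^~ b3)) // (linear_comb (Y := k^o) (g := om b)) //.
apply: eq_bigr => i _; apply: (congr1 (fun z : k^o => v2r b2 0 i *: z)).
rewrite (vect_decomp b3) (linear_comb (g := @tens k B B _)) //.
rewrite (linear_comb (Y := k^o) (g := om2 om s)) //.
rewrite (linear_comb (g := dm _)) // (linear_comb (Y := k^o) (g := om b)) //.
by apply: eq_bigr => j _; congr (_ *: _); apply: NE.
Qed.

End NuTheory.

Section ASI.
Variables (k : fieldType) (A : vectType k) (m : A -> A -> A).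

Record asi_bialgebra (Delta : A -> tensor A A) : Prop := ASIBialgebra {
  asi_bilinear : bilinear_map m;
  asi_assoc : associative m;
  asi_linear : linear Delta;
  asi_coassoc : coassociative Delta;
  asi_compat : forall a1 a2,
    Delta (m a1 a2) =
      tmap (rmul m a2) id (Delta a1) + tmap id (lmul m a1) (Delta a2);
  asi_antisym : forall a1 a2,
    tmap (lmul m a1) id (Delta a2) - tmap id (rmul m a1) (Delta a2) =
    tau (tmap id (rmul m a2) (Delta a1) - tmap (lmul m a2) id (Delta a1)) }.

Definition assoc_YBE (I : finType) (u v : I -> A) : Prop :=
  \sum_i \sum_j
     (m (u i) (u j) *t v i *t v j + u i *t u j *t m (v i) (v j)
      - u j *t m (u i) (v j) *t v i) = 0.

Definition Delta_of (s : tensor A A) (a : A) : tensor A A :=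
  tmap id (lmul m a) s - tmap (rmul m a) id s.

Definition triangular_asi (Delta : A -> tensor A A) : Prop :=
  asi_bialgebra Delta /\
  exists (I : finType) (u v : I -> A),
    let s := \sum_i u i *t v i in
    [/\ tau s = - s, assoc_YBE u v & Delta =1 Delta_of s].

End ASI.

Section Induced.
Variables (k : fieldType) (D B : vectType k).

Definition ind_mul (da vd : D -> D -> D) (dm : B -> B -> B)
    (s t : tensor D B) : tensor D B :=
  tlift (fun d1 b1 =>
    tlift (fun d2 b2 => vd d1 d2 *t dm b1 b2 + da d1 d2 *t dm b2 b1) t) s.

Definition ind_Delta (th_da th_vd : D -> tensor D D) (nu : B -> tensor B B) :
    tensor D B -> tensor (tensor D B) (tensor D B) :=
  tlift (fun d b =>
    bullet (th_vd d) (nu b) + bullet (th_da d) (tau (nu b))).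

End Induced.

(* Main.v *)
From HB Require Import structures.
Require Import Defs.
From mathcomp Require Import all_boot all_order all_algebra.

Set Implicit Arguments.
Unset Strict Implicit.
Unset Printing Implicit Defensive.

Import GRing.Theory.
Local Open Scope ring_scope.

(* Write r as a sum of x_i (x) y_i. Testing against the dual bases, every sum
   over e_j, f_j becomes a combination of the f_a (x) f_b (x) f_c whose
   coefficients are values of G(a,b,c) = om (a <> b) c. These satisfy
   G(a,b,c) = G(c,b,a) and G(a,b,c) + G(a,c,b) + G(c,a,b) = 0. Hence the
   associative Yang-Baxter equation for the induced tensor splits into the
   diassociative one and its cyclic rotation, which is equivalent to it because
   r is symmetric. The induced tensor is skew-symmetric, so it defines a
   coboundary ASI bialgebra, and the same coefficients identify its coproduct
   with the induced one. *)

(** * Linear and bilinear calculus on tensor products *)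

Section TensorToolkit.
Variable k : fieldType.
Implicit Types U V W X : vectType k.

HB.instance Definition _ U V :=
  bilinear_isBilinear.Build k U V (tensor U V) *:%R *:%R (@tens k U V)
    (tens_bilinear U V).

HB.instance Definition _ U V (W : lmodType k) (f : U -> V -> W) :=
  GRing.isLinear.Build k (tensor U V) W *:%R (tlift f) (tlift_linear f).

HB.instance Definition _ U V W X (f : U -> W) (g : V -> X) :=
  GRing.isLinear.Build k (tensor U V) (tensor W X) *:%R (tmap f g)
    (tlift_linear _).

HB.instance Definition _ U V :=
  GRing.isLinear.Build k (tensor U V) (tensor V U) *:%R (@tau k U V)
    (tlift_linear _).

HB.instance Definition _ U V W :=
  GRing.isLinear.Build k (tensor (tensor U V) W) (tensor U (tensor V W)) *:%R
    (@tassoc k U V W) (tlift_linear _).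

(** While [tlift_linear] concerns the tensor argument, this is linearity in the lifted function. It
    makes nested lifts bilinear and [Delta_of m s] linear in the acting element. *)
Lemma tlift_param_linear U V (W : lmodType k) (f g h : U -> V -> W) a t :
  (forall u v, h u v = a *: f u v + g u v) ->
  tlift h t = a *: tlift f t + tlift g t.
Proof.
move=> E; rewrite /tlift scaler_sumr -big_split; apply: eq_bigr => i _ /=.
rewrite scaler_sumr -big_split; apply: eq_bigr => j _ /=.
by rewrite E scalerDr !scalerA mulrC.
Qed.

Lemma eq_tmap U V W X (f f' : U -> W) (g g' : V -> X) :
  f =1 f' -> g =1 g' -> tmap f g =1 tmap f' g'.
Proof.
by move=> ff gg t; do 2!apply: eq_bigr => ? _; rewrite ff gg.
Qed.

Section Tlift2.
Variables (U V U' V' : vectType k) (W : lmodType k).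
Variable F : U -> V -> U' -> V' -> W.
Hypothesis F12 : forall u' v', bilinear_map (fun u v => F u v u' v').
Hypothesis F34 : forall u v, bilinear_map (F u v).

Let inner_bilinear t : bilinear_map (fun u v => tlift (F u v) t).
Proof.
by split=> [v|u] a x y; apply: tlift_param_linear => u' v';
  case: (F12 u' v') => L R; rewrite (L, R).
Qed.

(** Both [bullet] and [ind_mul] are nested lifts of this shape. This lemma and the next one give
    their bilinearity and their values on pure tensors. *)
Lemma tlift2_bilinear :
  bilinear_map (fun s t => tlift (fun u v => tlift (F u v) t) s).
Proof.
split=> [t|s] a x y; first exact: tlift_linear.
by apply: tlift_param_linear => u v; apply: tlift_linear.
Qed.

Lemma tlift2_tens u v u' v' :
  tlift (fun u v => tlift (F u v) (u' *t v')) (u *t v) = F u v u' v'.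
Proof. by rewrite tlift_tens ?tlift_tens. Qed.

End Tlift2.

Lemma tau_tens U V (u : U) (v : V) : tau (u *t v) = v *t u.
Proof.
by rewrite /tau tlift_tens //; split=> [y|x] a z w; rewrite ?linearPr ?linearPl.
Qed.

Lemma tmap_tens U V W X (f : U -> W) (g : V -> X) u v :
  linear f -> linear g -> tmap f g (u *t v) = f u *t g v.
Proof.
move=> lf lg; rewrite /tmap tlift_tens //.
by split=> [y|x] a z w; rewrite ?lf ?lg ?linearPr ?linearPl.
Qed.

Lemma tassoc_tens U V W (u : U) (v : V) (w : W) :
  tassoc ((u *t v) *t w) = u *t v *t w.
Proof.
rewrite /tassoc tlift_tens ?tlift_tens //.
  by split=> [y|x] a z t; rewrite ?linearPr ?linearPl ?linearPr.
split=> [y|x] a z t; first exact: tlift_linear.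
by apply: tlift_param_linear => u' v'; rewrite !linearPr.
Qed.

Section Bullet.
Variables U V W X : vectType k.
Let F (u : U) (v : V) (w : W) (x : X) := (u *t w) *t (v *t x).
Let F12 w x : bilinear_map (fun u v => F u v w x).
Proof. by split=> [y|y] a z t; rewrite /F ?linearPl ?linearPr ?linearPl. Qed.
Let F34 u v : bilinear_map (F u v).
Proof. by split=> [y|y] a z t; rewrite /F ?linearPr ?linearPl ?linearPr. Qed.

HB.instance Definition _ := bilinear_isBilinear.Build k (tensor U V) (tensor W X)
  (tensor (tensor U W) (tensor V X)) *:%R *:%R (@bullet k U V W X)
  (tlift2_bilinear F).

Lemma bullet_tens (u : U) (v : V) (w : W) (x : X) :
  bullet (u *t v) (w *t x) = (u *t w) *t (v *t x).
Proof. exact: (tlift2_tens F12 F34). Qed.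

End Bullet.

Section TmapSums.
Variables (U V W : vectType k) (I : Type) (r : seq I) (u : I -> U) (v : I -> V).

Lemma tmap_l_sum (f : U -> W) : linear f ->
  tmap f id (\sum_(i <- r) u i *t v i) = \sum_(i <- r) f (u i) *t v i.
Proof.
by move=> lf; rewrite linear_sum; apply: eq_bigr => i _ /=; rewrite tmap_tens.
Qed.

Lemma tmap_r_sum (f : V -> W) : linear f ->
  tmap id f (\sum_(i <- r) u i *t v i) = \sum_(i <- r) u i *t f (v i).
Proof.
by move=> lf; rewrite linear_sum; apply: eq_bigr => i _ /=; rewrite tmap_tens.
Qed.

Lemma tau_sum :
  tau (\sum_(i <- r) u i *t v i) = \sum_(i <- r) v i *t u i.
Proof. by rewrite linear_sum; apply: eq_bigr => i _ /=; rewrite tau_tens. Qed.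

End TmapSums.

End TensorToolkit.

(** * Multiplication operators and the coproduct defined by a tensor *)

Section BilinearActions.
Variables (k : fieldType) (U : vectType k) (m : {bilinear U -> U -> U}).

Lemma lmul_linear a : linear (lmul m a).
Proof. by move=> c x y; rewrite /lmul linearPr. Qed.

Lemma rmul_linear a : linear (rmul m a).
Proof. by move=> c x y; rewrite /rmul linearPl. Qed.

Lemma Delta_of_linear s : linear (Delta_of m s).
Proof.
have [tl tr] := @tens_bilinear k U U.
move=> c a b; rewrite /Delta_of scalerBr addrACA -opprD; congr (_ - _).
  by apply: tlift_param_linear => u v; rewrite /lmul linearPl linearPr.
by apply: tlift_param_linear => u v; rewrite /rmul linearPr linearPl.
Qed.

Lemma Delta_ofE (I : finType) (u v : I -> U) a :
  Delta_of m (\sum_i u i *t v i) a = \sum_i (u i *t m a (v i) - m (u i) a *t v i).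
Proof.
by rewrite /Delta_of tmap_r_sum ?tmap_l_sum ?sumrB //;
  [apply: rmul_linear | apply: lmul_linear].
Qed.

End BilinearActions.

#[local] Hint Resolve lmul_linear rmul_linear Delta_of_linear : core.

(** * Coboundary ASI bialgebras from skew-symmetric solutions of the associative Yang-Baxter
    equation *)

Section Coboundary.
Variables (k : fieldType) (A : vectType k) (m : {bilinear A -> A -> A}).
Hypothesis mA : associative m.
Variables (I : finType) (u v : I -> A).
Let s := \sum_i u i *t v i.
Let Delta := Delta_of m s.

Let tmap_l3 a (x y z : I -> I -> A) :
  tmap id (tmap id (lmul m a)) (\sum_i \sum_j x i j *t y i j *t z i j) =
  \sum_i \sum_j x i j *t y i j *t m a (z i j).
Proof.
rewrite linear_sum; apply: eq_bigr => i _; rewrite linear_sum.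
apply: eq_bigr => j _ /=; rewrite tmap_tens ?tmap_tens //.
exact: linearP.
Qed.

Let tmap_r3 a (x y z : I -> I -> A) :
  tmap (rmul m a) id (\sum_i \sum_j x i j *t y i j *t z i j) =
  \sum_i \sum_j m (x i j) a *t y i j *t z i j.
Proof.
rewrite linear_sum; apply: eq_bigr => i _; rewrite linear_sum.
by apply: eq_bigr => j _ /=; rewrite tmap_tens //; apply: rmul_linear.
Qed.

(** Isolating the negative term turns the equation into a rewriting rule for that term. *)
Lemma assoc_YBE_sums : assoc_YBE m u v ->
  \sum_i \sum_j u j *t m (u i) (v j) *t v i =
  \sum_i \sum_j m (u i) (u j) *t v i *t v j +
  \sum_i \sum_j u i *t u j *t m (v i) (v j).
Proof.
move=> Y; apply/esym/subr0_eq; apply: etrans Y.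
rewrite -big_split -sumrB; apply: eq_bigr => i _ /=.
by rewrite -big_split -sumrB.
Qed.

(** Each side expands into four double sums. The sum with [m (m (u i) a) (v j)] in the middle leg is
    common to both. The others match by two images of the Yang-Baxter equation: [a] multiplying the
    third leg from the left, and [a] multiplying the first leg from the right. *)
Lemma Delta_of_coassoc : assoc_YBE m u v -> coassociative Delta.
Proof.
move=> /assoc_YBE_sums Y a.
have Dl : linear Delta by apply: Delta_of_linear.
have T x y : tassoc (Delta x *t y) =
    \sum_j (u j *t m x (v j) *t y - m (u j) x *t v j *t y).
  rewrite /Delta Delta_ofE linear_sumlz linear_sum; apply: eq_bigr => j _ /=.
  by rewrite linearBl linearB /= !tassoc_tens.
have E1 : tassoc (tmap Delta id (Delta a)) =
    (\sum_i \sum_j u j *t m (u i) (v j) *t m a (v i)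
     - \sum_i \sum_j m (u i) (u j) *t v i *t m a (v j))
    - (\sum_i \sum_j u j *t m (m (u i) a) (v j) *t v i
       - \sum_i \sum_j m (m (u i) (u j)) a *t v i *t v j).
  (* The expansion produces these terms with [i] indexing the outer coproduct. Exchanging the two
     indices in two of the sums gives the shape in which the Yang-Baxter equation applies. *)
  rewrite [RHS](_ : _ = \sum_i \sum_j (u j *t m (u i) (v j) *t m a (v i)
      - m (u j) (u i) *t v j *t m a (v i)
      - (u j *t m (m (u i) a) (v j) *t v i
         - m (u j) (m (u i) a) *t v j *t v i))); last first.
    rewrite [X in _ - X - _ = _]exchange_big [X in _ - (_ - X) = _]exchange_big.
    rewrite -!sumrB; apply: eq_bigr => i _ /=.
    by rewrite -!sumrB; apply: eq_bigr => j _ /=; rewrite mA.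
  rewrite [Delta a]Delta_ofE [tmap _ _ _]linear_sum linear_sum /=.
  apply: eq_bigr => i _; rewrite linearB linearB /= !tmap_tens //.
  by rewrite !T -sumrB.
have E2 : tmap id Delta (Delta a) =
    (\sum_i \sum_j u i *t u j *t m a (m (v i) (v j))
     - \sum_i \sum_j u j *t m (m (u i) a) (v j) *t v i)
    - (\sum_i \sum_j m (u i) a *t u j *t m (v i) (v j)
       - \sum_i \sum_j m (u j) a *t m (u i) (v j) *t v i).
  rewrite [RHS](_ : _ = \sum_i \sum_j (u i *t u j *t m (m a (v i)) (v j)
      - u i *t m (u j) (m a (v i)) *t v j
      - (m (u i) a *t u j *t m (v i) (v j)
         - m (u i) a *t m (u j) (v i) *t v j))); last first.
    rewrite [X in _ - X - _ = _]exchange_big [X in _ - (_ - X) = _]exchange_big.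
    rewrite -!sumrB; apply: eq_bigr => i _ /=.
    by rewrite -!sumrB; apply: eq_bigr => j _ /=; rewrite !mA.
  rewrite [Delta a]Delta_ofE linear_sum /=.
  apply: eq_bigr => i _; rewrite linearB /= !tmap_tens // /Delta !Delta_ofE.
  rewrite !linear_sumr -sumrB; apply: eq_bigr => j _ /=.
  by rewrite !linearBr.
(* [Yl] replaces the first sum of [E1] and [Yr] the last sum of [E2]; what then remains is the same
   on both sides. *)
have Yl := congr1 (tmap id (tmap id (lmul m a))) Y.
have Yr := congr1 (tmap (rmul m a) id) Y.
rewrite linearD /= !tmap_l3 in Yl; rewrite linearD /= !tmap_r3 in Yr.
rewrite E1 E2 {}Yl {}Yr.
by rewrite [X in X - _ - _]addrC addrK !opprB addrK addrA addrAC.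
Qed.

(** The cross terms [m (u i) b *t m a (v i)] of the two summands on the right cancel, and
    associativity identifies the rest. *)
Lemma Delta_of_derivation a b :
  Delta (m a b) = tmap (rmul m b) id (Delta a) + tmap id (lmul m a) (Delta b).
Proof.
rewrite /Delta !Delta_ofE [tmap (rmul m b) _ _]linear_sum /=.
rewrite [tmap id (lmul m a) _]linear_sum -big_split /=; apply: eq_bigr => i _.
by rewrite !linearB /= !tmap_tens // /lmul /rmul !mA [RHS]addrC addrA subrK.
Qed.

Lemma Delta_of_antisym a b : tau s = - s ->
  tmap (lmul m a) id (Delta b) - tmap id (rmul m a) (Delta b) =
  tau (tmap id (rmul m b) (Delta a) - tmap (lmul m b) id (Delta a)).
Proof.
move=> skew.
(* Skew-symmetry in usable form: under any two linear maps the legs of [s] may be exchanged at the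
   cost of a sign. *)
have skew_sum (f g : A -> A) : linear f -> linear g ->
    \sum_i f (v i) *t g (u i) = - \sum_i f (u i) *t g (v i).
  move=> lf lg; have := congr1 (tmap f g) skew; rewrite linearN /s tau_sum.
  have tmap_sum x y : tmap f g (\sum_i x i *t y i) = \sum_i f (x i) *t g (y i).
    by rewrite linear_sum; apply: eq_bigr => i _ /=; rewrite tmap_tens.
  by rewrite /= !tmap_sum.
have ll c d : tmap (lmul m c) id (Delta d) =
    \sum_i m c (u i) *t m d (v i) - \sum_i m (m c (u i)) d *t v i.
  rewrite /Delta Delta_ofE [tmap _ _ _]linear_sum -sumrB; apply: eq_bigr => i _ /=.
  by rewrite linearB /= !tmap_tens // /lmul mA.
have rr c d : tmap id (rmul m c) (Delta d) =
    \sum_i u i *t m d (m (v i) c) - \sum_i m (u i) d *t m (v i) c.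
  rewrite /Delta Delta_ofE [tmap _ _ _]linear_sum -sumrB; apply: eq_bigr => i _ /=.
  by rewrite linearB /= !tmap_tens // /rmul mA.
have tauB (x y : tensor A A) : tau (x - y) = tau x - tau y by exact: linearB.
(* After the flip, the right-hand side consists of four sums with [v i] in the first leg and [u i]
   in the second. [S1] to [S4] restore the order of the legs in these sums, one each. *)
rewrite !tauB !ll !rr !tauB !tau_sum.
have S1 := skew_sum (fun x => m a (m x b)) id.
have S2 := skew_sum (rmul m b) (rmul m a).
have S3 := skew_sum (lmul m a) (lmul m b).
have S4 := skew_sum id (fun x => m (m b x) a).
have lin c d : linear (fun x => m c (m x d)).
  by move=> z x y; rewrite linearPl linearPr.
rewrite S1 // S2 // S3 // S4 //; last first.
  by move=> z x y; rewrite linearPr linearPl.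
rewrite /lmul /rmul !opprK.
under [X in _ = - X + _ - _]eq_bigr do rewrite mA.
under [X in _ - (X - _) = _]eq_bigr do rewrite mA.
rewrite !opprB !opprD !opprK [RHS]addrC [in RHS]addrACA.
by congr (_ + _); rewrite addrC.
Qed.

Lemma Delta_of_asi : tau s = - s -> assoc_YBE m u v -> asi_bialgebra m Delta.
Proof.
move=> skew Y; split=> //.
- by split=> [y|x] a z t; rewrite ?linearPr ?linearPl.
- exact: Delta_of_linear.
- exact: Delta_of_coassoc.
- exact: Delta_of_derivation.
- by move=> a b; apply: Delta_of_antisym.
Qed.

End Coboundary.

(** * Sums over a pair of dual bases of a skew form *)

Section DualBases.
Variables (k : fieldType) (B : vectType k) (om : {biscalar B}).
Hypothesis om_skew : forall a b, om a b = - om b a.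
Variables (n : nat) (e f : 'I_n -> B).
Hypothesis expand : forall b, b = \sum_j om b (e j) *: f j.

Section TwoLegs.
Variables (W : lmodType k) (Psi : B -> B -> W).
Hypothesis PsiB : bilinear_map Psi.

(** Expanding each [e j] in the [f i] turns the left side into a double sum weighted by the Gram
    matrix [om (e j) (e i)], which is skew. Expanding the right side in the same way gives the
    transposed weights. *)
Lemma dual_bases_skew : \sum_j Psi (e j) (f j) = - \sum_j Psi (f j) (e j).
Proof.
have [Psil Psir] := PsiB.
have -> : \sum_j Psi (e j) (f j) =
    \sum_j \sum_i om (e j) (e i) *: Psi (f i) (f j).
  apply: eq_bigr => j _; rewrite {1}(expand (e j)).
  by rewrite (linear_comb (g := Psi^~ (f j))).
rewrite exchange_big -sumrN; apply: eq_bigr => i _ /=.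
rewrite [in RHS](expand (e i)) (linear_comb (g := Psi (f i))) // -sumrN.
by apply: eq_bigr => j _; rewrite om_skew scaleNr.
Qed.

Lemma dual_bases_expand_l (p : B -> B) :
  \sum_j Psi (p (e j)) (f j) =
  \sum_a \sum_c om (p (e c)) (e a) *: Psi (f a) (f c).
Proof.
have [Psil Psir] := PsiB; rewrite exchange_big; apply: eq_bigr => c _ /=.
by rewrite {1}(expand (p _)) (linear_comb (g := Psi^~ (f c))).
Qed.

Lemma dual_bases_expand_r (p : B -> B) :
  \sum_j Psi (f j) (p (e j)) =
  \sum_a \sum_c om (p (e a)) (e c) *: Psi (f a) (f c).
Proof.
have [Psil Psir] := PsiB; apply: eq_bigr => a _ /=.
by rewrite {1}(expand (p _)) (linear_comb (g := Psi (f a))).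
Qed.

End TwoLegs.

Lemma dual_bases_skew_r (W : lmodType k) (Psi : B -> B -> W) (p : B -> B) :
    bilinear_map Psi -> linear p ->
  \sum_j Psi (e j) (p (f j)) =
  - \sum_a \sum_c om (p (e a)) (e c) *: Psi (f a) (f c).
Proof.
move=> PsiB lp; rewrite -dual_bases_expand_r //.
apply: (dual_bases_skew (Psi := fun x y => Psi x (p y))).
have [Psil Psir] := PsiB.
by split=> [y|x] a z t; rewrite ?Psil ?lp ?Psir.
Qed.

Section ThreeLegs.
Variables (W : lmodType k) (Psi : B -> B -> B -> W) (p : B -> B -> B).
Hypothesis Psi1 : forall y z, linear (fun x => Psi x y z).
Hypothesis Psi2 : forall x z, linear (fun y => Psi x y z).
Hypothesis Psi3 : forall x y, linear (Psi x y).
Hypothesis pB : bilinear_map p.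

(** This and the next two lemmas rewrite the [B]-parts of the three terms of the associative
    Yang-Baxter equation over the common family of triples [f a], [f b], [f c]. Here only the
    product leg has to be expanded. *)
Lemma dual_bases_prod1 :
  \sum_j \sum_l Psi (p (e j) (e l)) (f j) (f l) =
  \sum_a \sum_b \sum_c om (p (e b) (e c)) (e a) *: Psi (f a) (f b) (f c).
Proof.
rewrite [RHS]exchange_big; apply: eq_bigr => b _; rewrite exchange_big /=.
apply: eq_bigr => c _; rewrite {1}(expand (p _ _)).
by rewrite (linear_comb (g := fun x => Psi x (f b) (f c))).
Qed.

(** Both factors of the product are dual vectors. Two exchanges by [dual_bases_skew] turn them into
    basis vectors, and the two signs cancel. *)
Lemma dual_bases_prod3 :
  \sum_j \sum_l Psi (e j) (e l) (p (f j) (f l)) =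
  \sum_a \sum_b \sum_c om (p (e a) (e b)) (e c) *: Psi (f a) (f b) (f c).
Proof.
have [pl pr] := pB.
have -> : \sum_j \sum_l Psi (e j) (e l) (p (f j) (f l)) =
    - \sum_j \sum_l Psi (e j) (f l) (p (f j) (e l)).
  rewrite -sumrN; apply: eq_bigr => j _.
  apply: (dual_bases_skew (Psi := fun x y => Psi (e j) x (p (f j) y))).
  by split=> [y|x] a z t; rewrite ?Psi2 ?pr ?Psi3.
rewrite exchange_big -sumrN [RHS]exchange_big; apply: eq_bigr => l _ /=.
rewrite (dual_bases_skew (Psi := fun x y => Psi x (f l) (p y (e l)))) ?opprK.
  apply: eq_bigr => j _; rewrite {1}(expand (p _ _)).
  by rewrite (linear_comb (g := Psi _ _)).
by split=> [y|x] a z t; rewrite ?Psi1 ?pl ?Psi3.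
Qed.

(** Only one factor of the product is a dual vector, so a single exchange is made and its sign
    survives. *)
Lemma dual_bases_prod2 :
  \sum_j \sum_l Psi (e l) (p (e j) (f l)) (f j) =
  - \sum_a \sum_b \sum_c om (p (e c) (e a)) (e b) *: Psi (f a) (f b) (f c).
Proof.
have [pl pr] := pB.
have -> : \sum_j \sum_l Psi (e l) (p (e j) (f l)) (f j) =
    - \sum_j \sum_l Psi (f l) (p (e j) (e l)) (f j).
  rewrite -sumrN; apply: eq_bigr => j _.
  apply: (dual_bases_skew (Psi := fun x y => Psi x (p (e j) y) (f j))).
  by split=> [y|x] a z t; rewrite ?Psi1 ?pr ?Psi2.
congr (- _); rewrite exchange_big; apply: eq_bigr => l _; rewrite exchange_big.
apply: eq_bigr => j _ /=; rewrite {1}(expand (p _ _)).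
by rewrite (linear_comb (g := fun x => Psi (f l) x (f j))).
Qed.

End ThreeLegs.

End DualBases.

(** * Identities of the invariant form, and existence of dual bases *)

Section QuadraticZinbielTheory.
Variables (k : fieldType) (B : vectType k) (dm : B -> B -> B).
Variable om : B -> B -> k.
Hypothesis hB : quadratic_zinbiel dm om.

(** Invariance moves the product to the second argument, and skewness then turns the two resulting
    terms into the negatives of the last two. *)
Lemma zinbiel_form_cyclic a b c :
  om (dm a b) c + om (dm a c) b + om (dm c a) b = 0.
Proof.
have [oml omr] := om_bilinear hB.
have omD x y : om b (x + y) = om b x + om b y.
  by have /= := omr b 1 x y; rewrite scale1r mul1r.
by rewrite (om_invariant hB) omD !(om_skew hB b) -addrA addrC -opprD subrr.
Qed.

(** Two instances of the cyclic identity share two of their three terms, so the third terms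
    agree. *)
Lemma zinbiel_form_flip a b c : om (dm a b) c = om (dm c b) a.
Proof.
have := zinbiel_form_cyclic b a c; rewrite -(zinbiel_form_cyclic b c a).
by rewrite [X in X + _ = _]addrC => /addrI.
Qed.

Section Expand.
Variables (n : nat) (e f : 'I_n -> B).
Hypothesis dual : forall i j, om (f i) (e j) = (i == j)%:R.
Hypothesis span : forall b, exists c : 'I_n -> k, b = \sum_j c j *: e j.

(** Both sides have the same pairing with every combination of the [e j], hence with every vector,
    and the form is nondegenerate. This provides the hypothesis [expand] under which the sums over
    dual bases are computed. *)
Lemma dual_basis_expand b : b = \sum_j om b (e j) *: f j.
Proof.
have [oml omr] := om_bilinear hB.
apply/subr0_eq/(om_nondeg hB) => b'.
have omB x y : om (x - y) b' = om x b' - om y b'.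
  by have /= := oml b' (-1) y x; rewrite scaleN1r mulN1r ![- _ + _]addrC.
rewrite omB; apply/eqP; rewrite subr_eq0; apply/eqP.
have [c ->] := span b'.
rewrite (linear_comb (Y := k^o) (g := om b)) //.
rewrite (linear_comb (Y := k^o) (g := om^~ _)) //.
apply: eq_bigr => j _; rewrite (linear_comb (Y := k^o) (g := om (f j))) //.
rewrite (bigD1 j) //= dual eqxx big1 => [|i ij]; last first.
  by rewrite dual eq_sym (negPf ij) scaler0.
by rewrite addr0 /GRing.scale /= mulr1 mulrC.
Qed.

End Expand.

(** The rows of the inverse Gram matrix are the coordinates of the dual basis. The Gram matrix is
    invertible because a row vector in its kernel gives a combination of the basis orthogonal to all
    of [B], which is zero by nondegeneracy and has zero coefficients by freeness. *)
Lemma dual_basis_exists n (e : n.-tuple B) : basis_of fullv e ->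
  exists f : n.-tuple B,
    forall i j : 'I_n, om (tnth f i) (tnth e j) = (i == j)%:R.
Proof.
move=> /andP[/eqP span_e free_e].
have [oml omr] := om_bilinear hB; move/freeP in free_e.
pose M : 'M[k]_n := \matrix_(i, j) om (tnth e i) (tnth e j).
have omM (c : 'I_n -> k) j :
    om (\sum_i c i *: tnth e i) (tnth e j) = \sum_i c i * M i j.
  rewrite (linear_comb (Y := k^o) (g := om^~ _)) //.
  by apply: eq_bigr => i _; rewrite mxE.
have M_unit : M \in unitmx.
  rewrite -row_free_unit -kermx_eq0; apply/rowV0P => u /sub_kermxP uM.
  suff u0 : \sum_i u 0 i *: e`_i = 0.
    by apply/rowP=> i; rewrite mxE; apply: (free_e (fun i => u 0 i)).
  apply: (om_nondeg hB) => b.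
  have /coord_span -> : b \in <<e>>%VS by rewrite span_e memvf.
  rewrite (linear_comb (Y := k^o) (g := om _)) //; apply: big1 => j _.
  rewrite -!tnth_nth (eq_bigr (fun i => u 0 i *: tnth e i)); last first.
    by move=> i _; rewrite (tnth_nth 0).
  rewrite omM; have := congr1 (fun v : 'rV_n => v 0 j) uM; rewrite !mxE => ->.
  by rewrite /GRing.scale /= mulr0.
exists [tuple \sum_l invmx M i l *: tnth e l | i < n] => i j.
rewrite tnth_mktuple omM; have := congr1 (fun N : 'M_n => N i j) (mulVmx M_unit).
by rewrite !mxE.
Qed.

End QuadraticZinbielTheory.

(** * The diassociative Yang-Baxter equation for a symmetric tensor *)

Section SymmetricYBE.
Variables (k : fieldType) (D : vectType k) (da vd : {bilinear D -> D -> D}).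
Variables (I : finType) (x y : I -> D).
Hypothesis sym : tau (\sum_i x i *t y i) = \sum_i x i *t y i.

(** The lift of [phi] is applied to the identity [tau r = r]. Later uses exchange [x i] and [y i]
    inside larger tensor expressions. *)
Lemma symmetric_swap (W : lmodType k) (phi : D -> D -> W) :
  bilinear_map phi -> \sum_i phi (x i) (y i) = \sum_i phi (y i) (x i).
Proof.
move=> phiB; have := congr1 (tlift phi) sym; rewrite tau_sum !linear_sum /=.
under eq_bigr do rewrite tlift_tens //.
by under [X in _ = X -> _]eq_bigr do rewrite tlift_tens //.
Qed.

Let rot : tensor D (tensor D D) -> tensor D (tensor D D) :=
  tlift (fun a s => tlift (fun b c => c *t a *t b) s).

Let rot_tens a b c : rot (a *t b *t c) = c *t a *t b.
Proof.
rewrite /rot !tlift_tens //.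
  by split=> [u|u] z s t; rewrite ?linearPl ?linearPr ?linearPl ?linearPr.
split=> [u|u] z s t; last exact: tlift_linear.
by apply: tlift_param_linear => b' c'; rewrite linearPl linearPr.
Qed.

Let rot_sum (a b c : I -> I -> D) :
  rot (\sum_i \sum_j a i j *t b i j *t c i j) =
  \sum_i \sum_j c i j *t a i j *t b i j.
Proof.
rewrite /rot linear_sum; apply: eq_bigr => i _ /=; rewrite linear_sum.
by apply: eq_bigr => j _; apply: rot_tens.
Qed.

Lemma diass_YBE_sums : diass_YBE da vd x y ->
  \sum_i \sum_j da (x i) (x j) *t y i *t y j
    + \sum_i \sum_j x i *t x j *t vd (y i) (y j) =
  \sum_i \sum_j vd (x i) (x j) *t y i *t y j
    + \sum_i \sum_j x j *t da (x i) (y j) *t y i.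
Proof.
move=> Y; apply/subr0_eq; apply: etrans Y.
rewrite -!big_split -sumrB; apply: eq_bigr => i _ /=.
rewrite -!big_split -sumrB; apply: eq_bigr => j _ /=.
by rewrite opprD [RHS]addrC !addrA [LHS]addrAC.
Qed.

(* Cyclic rotation of the tensor factors permutes the terms of the
   Yang-Baxter equation once r is symmetric. *)
Lemma diass_YBE_rot : diass_YBE da vd x y ->
  \sum_i \sum_j vd (x i) (x j) *t y i *t y j
    + \sum_i \sum_j x j *t da (x i) (y j) *t y i =
  \sum_i \sum_j x i *t x j *t da (y i) (y j)
    + \sum_i \sum_j x j *t vd (x i) (y j) *t y i.
Proof.
move=> /diass_YBE_sums Y; have := congr1 rot Y.
rewrite /rot !linearD -!/rot /= -/rot !rot_sum => E.
(* Rotation leaves some [x] and [y] in exchanged positions. Symmetry of r is used in one index for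
   [middle] and [last], and in both indices for [first]. *)
have middle (p : {bilinear D -> D -> D}) :
    \sum_i \sum_j y j *t p (x i) (x j) *t y i =
    \sum_i \sum_j x j *t p (x i) (y j) *t y i.
  apply: eq_bigr => i _.
  rewrite (symmetric_swap (phi := fun a b => a *t p (x i) b *t y i)) //.
  by split=> [u|u] z s t; rewrite ?linearPl ?linearPr ?linearPl ?linearPr.
have last (p : {bilinear D -> D -> D}) :
    \sum_i \sum_j y i *t x j *t p (x i) (y j) =
    \sum_i \sum_j x i *t x j *t p (y i) (y j).
  rewrite exchange_big [RHS]exchange_big; apply: eq_bigr => j _ /=.
  rewrite (symmetric_swap (phi := fun a b => a *t x j *t p b (y j))) //.
  by split=> [u|u] z s t; rewrite !(linearPl, linearPr).
have first (p : {bilinear D -> D -> D}) :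
    \sum_i \sum_j p (y i) (y j) *t x i *t x j =
    \sum_i \sum_j p (x i) (x j) *t y i *t y j.
  rewrite (eq_bigr (fun i => \sum_j p (y i) (x j) *t x i *t y j)) => [|i _].
    rewrite exchange_big [RHS]exchange_big; apply: eq_bigr => j _ /=.
    rewrite (symmetric_swap (phi := fun a b => p b (x j) *t a *t y j)) //.
    by split=> [u|u] z s t; rewrite !(linearPl, linearPr).
  rewrite (symmetric_swap (phi := fun a b => p (y i) b *t x i *t a)) //.
  by split=> [u|u] z s t; rewrite !(linearPl, linearPr).
by rewrite !middle last first in E; rewrite addrC E addrC.
Qed.

End SymmetricYBE.

(** * Associativity of the induced product on the tensor product of [D] and [B] *)

Section InducedAlgebra.
Variables (k : fieldType) (D B : vectType k).
Variables (da vd : {bilinear D -> D -> D}) (dm : {bilinear B -> B -> B}).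

Let F d1 b1 d2 b2 : tensor D B := vd d1 d2 *t dm b1 b2 + da d1 d2 *t dm b2 b1.
Let F12 d2 b2 : bilinear_map (fun d1 b1 => F d1 b1 d2 b2).
Proof.
split=> [b|d] z s t.
  by rewrite /F !linearPl /= addrACA -scalerDr.
by rewrite /F !(linearPl, linearPr) /= addrACA -scalerDr.
Qed.
Let F34 d1 b1 : bilinear_map (F d1 b1).
Proof.
split=> [b|d] z s t.
  by rewrite /F !(linearPl, linearPr) /= addrACA -scalerDr.
by rewrite /F !(linearPl, linearPr) /= addrACA -scalerDr.
Qed.

HB.instance Definition _ := bilinear_isBilinear.Build k (tensor D B) (tensor D B)
  (tensor D B) *:%R *:%R (ind_mul da vd dm) (tlift2_bilinear F).

Lemma ind_mul_tens d1 b1 d2 b2 :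
  ind_mul da vd dm (d1 *t b1) (d2 *t b2) =
  vd d1 d2 *t dm b1 b2 + da d1 d2 *t dm b2 b1.
Proof. exact: (tlift2_tens F12 F34). Qed.

Lemma ind_mul_assoc :
  diass_algebra da vd -> zinbiel_algebra dm -> associative (ind_mul da vd dm).
Proof.
move=> hD hB r s t; set m := ind_mul da vd dm.
have lin3 (p q : tensor D B -> tensor D B) : linear p -> linear q ->
    (forall d b, p (d *t b) = q (d *t b)) -> p =1 q by exact: tens_ext.
apply: (lin3 (fun r => m r (m s t)) (fun r => m (m r s) t)) => [c u v|c u v|d1 b1].
- by rewrite /= /m linearPl.
- by rewrite /= /m !linearPl.
apply: (lin3 (fun s => m _ (m s t)) (fun s => m (m _ s) t)) => [c u v|c u v|d2 b2].
- by rewrite /= /m linearPl linearPr.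
- by rewrite /= /m linearPr linearPl.
apply: (lin3 (m _ \o m _) (m (m _ _))) => [c u v|c u v|d3 b3] /=.
- by rewrite /= /m !linearPr.
- by rewrite /= /m linearPr.
rewrite /m !ind_mul_tens linearDr linearDl /= !ind_mul_tens.
(* The Zinbiel identity rewrites all triple products in [B] as left-nested ones. The diassociative
   axioms leave three triple products in [D], and both sides become the same six terms in a
   different order. *)
have zid := zinbiel_id hB.
rewrite (zid b1 b2 b3) (zid b1 b3 b2) (zid b3 b1 b2) (zid b3 b2 b1).
rewrite -(vd_assoc hD) (da_vd_vd hD) -(vd_assoc hD) -(da_da_vd hD) -(da_assoc hD).
rewrite !(vd_da_mixed hD) !linearDr /= !addrA.
by rewrite [RHS](ACl (1*4*6*3*2*5)).
Qed.

End InducedAlgebra.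

(** * The induced tensor: skew-symmetry, Yang-Baxter equation and coproduct *)

Section InducedTriangular.
Variables (k : fieldType) (D B : vectType k).
Variables (da vd : {bilinear D -> D -> D}) (dm : {bilinear B -> B -> B}).
Variable om : {biscalar B}.
Hypothesis hB : quadratic_zinbiel dm om.
Variables (n : nat) (e f : 'I_n -> B).
Hypothesis expand : forall b, b = \sum_j om b (e j) *: f j.
Variables (I : finType) (x y : I -> D).
Hypothesis sym : tau (\sum_i x i *t y i) = \sum_i x i *t y i.

Let om_skew := om_skew hB.
Let m := ind_mul da vd dm.
Let u (p : I * 'I_n) : tensor D B := x p.1 *t e p.2.
Let v (p : I * 'I_n) : tensor D B := y p.1 *t f p.2.

(** The sign comes from the [B]-part alone: symmetry of r undoes the flip on the [D]-part, and
    [dual_bases_skew] gives the minus on the other. *)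
Lemma ind_tensor_skew : tau (\sum_p u p *t v p) = - \sum_p u p *t v p.
Proof.
rewrite tau_sum -!(pair_bigA _ (fun i j => u (i, j) *t v (i, j))).
rewrite -(pair_bigA _ (fun i j => v (i, j) *t u (i, j))) /=.
rewrite exchange_big [X in _ = - X]exchange_big /=.
have swap j : \sum_i v (i, j) *t u (i, j) = \sum_i (x i *t f j) *t (y i *t e j).
  rewrite (symmetric_swap sym (phi := fun a b => (a *t f j) *t (b *t e j))) //.
  by split=> [b|a] z s t; rewrite !(linearPl, linearPr).
rewrite (eq_bigr _ (fun j _ => swap j)) exchange_big [X in _ = - X]exchange_big.
rewrite -sumrN; apply: eq_bigr => i _ /=; apply: oppr_inj; rewrite opprK.
rewrite -(dual_bases_skew om_skew expand
  (Psi := fun a b => (x i *t a) *t (y i *t b))) //.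
by split=> [b|a] z s t; rewrite !(linearPl, linearPr).
Qed.

Let T := tensor D B.
Let tr a b c : tensor D (tensor D D) -> tensor T (tensor T T) :=
  tmap (fun d => d *t f a) (tmap (fun d => d *t f b) (fun d => d *t f c)).
(** [S h t] merges [t], leg by leg, with the element of the triple tensor power of [B] whose
    coefficients over [f a], [f b], [f c] are [h a b c]. It separates the [D]-part of a term from
    its [B]-part. *)
Let S (h : 'I_n -> 'I_n -> 'I_n -> k) (t : tensor D (tensor D D)) :=
  \sum_a \sum_b \sum_c h a b c *: tr a b c t.

Let tr_tens a b c d1 d2 d3 :
  tr a b c (d1 *t d2 *t d3) = (d1 *t f a) *t (d2 *t f b) *t (d3 *t f c).
Proof.
rewrite /tr !tmap_tens //; try by move=> z s t; rewrite linearPl.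
exact: linearP.
Qed.

Let S_tens h d1 d2 d3 : S h (d1 *t d2 *t d3) =
  \sum_a \sum_b \sum_c h a b c *: ((d1 *t f a) *t (d2 *t f b) *t (d3 *t f c)).
Proof.
by do 3!apply: eq_bigr => ? _; rewrite tr_tens.
Qed.

Let S_sum h (t : I -> I -> tensor D (tensor D D)) :
  \sum_i \sum_j S h (t i j) = S h (\sum_i \sum_j t i j).
Proof.
have S1 (g : I -> tensor D (tensor D D)) : \sum_i S h (g i) = S h (\sum_i g i).
  rewrite /S exchange_big; apply: eq_bigr => a _; rewrite exchange_big.
  apply: eq_bigr => b _; rewrite exchange_big; apply: eq_bigr => c _.
  by rewrite -scaler_sumr /tr -linear_sum.
by rewrite -S1; apply: eq_bigr => i _; rewrite S1.
Qed.

Section Legs.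
Variables (d1 d2 d3 : D) (p : B -> B -> B).
Hypothesis pB : bilinear_map p.
Let Psi a b c : tensor T (tensor T T) := (d1 *t a) *t (d2 *t b) *t (d3 *t c).
Let Psi1 b c : linear (fun a => Psi a b c).
Proof. by move=> z s t; rewrite /Psi !(linearPl, linearPr). Qed.
Let Psi2 a c : linear (fun b => Psi a b c).
Proof. by move=> z s t; rewrite /Psi !(linearPl, linearPr). Qed.
Let Psi3 a b : linear (Psi a b).
Proof. by move=> z s t; rewrite /Psi !(linearPl, linearPr). Qed.

Lemma legs1 : \sum_j \sum_l Psi (p (e j) (e l)) (f j) (f l) =
  S (fun a b c => om (p (e b) (e c)) (e a)) (d1 *t d2 *t d3).
Proof. by rewrite S_tens (dual_bases_prod1 expand). Qed.

Lemma legs3 : \sum_j \sum_l Psi (e j) (e l) (p (f j) (f l)) =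
  S (fun a b c => om (p (e a) (e b)) (e c)) (d1 *t d2 *t d3).
Proof. by rewrite S_tens (dual_bases_prod3 om_skew expand). Qed.

Lemma legs2 : \sum_j \sum_l Psi (e l) (p (e j) (f l)) (f j) =
  - S (fun a b c => om (p (e c) (e a)) (e b)) (d1 *t d2 *t d3).
Proof. by rewrite S_tens (dual_bases_prod2 om_skew expand). Qed.

End Legs.

Lemma ind_assoc_YBE : diass_YBE da vd x y -> assoc_YBE m u v.
Proof.
move=> Y; rewrite /assoc_YBE.
pose term i j i' l := m (u (i, j)) (u (i', l)) *t v (i, j) *t v (i', l)
  + u (i, j) *t u (i', l) *t m (v (i, j)) (v (i', l))
  - u (i', l) *t m (u (i, j)) (v (i', l)) *t v (i, j).
(* The indices of [D] are moved outside, so that for fixed [i] and [i'] the two indices of [B] are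
   summed first. *)
transitivity (\sum_i \sum_i' \sum_j \sum_l term i j i' l).
  transitivity (\sum_i \sum_j \sum_q term i j q.1 q.2).
    rewrite (pair_bigA _ (fun i j => \sum_q term i j q.1 q.2)) /=.
    apply: eq_bigr => -[i j] _.
    by apply: eq_bigr => -[i' l] _.
  apply: eq_bigr => i _; rewrite exchange_big /=.
  by rewrite -(pair_bigA _ (fun i' l => \sum_j term i j i' l));
    apply: eq_bigr => i' _; rewrite exchange_big.
have [dml dmr] : bilinear_map dm.
  exact: zinbiel_bilinear (quadratic_zinbiel_alg hB).
have dmB : bilinear_map dm by [].
have mdB : bilinear_map (fun a b => dm b a) by [].
(* By [zinbiel_form_flip] a value of the trilinear form depends only on its middle argument once the
   three vectors are given. The three choices [e c], [e b], [e a] of the middle argument give [p],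
   [q] and [r]. *)
pose p a b c := om (dm (e b) (e c)) (e a).
pose q a b c := om (dm (e c) (e b)) (e a).
pose r a b c := om (dm (e b) (e a)) (e c).
have eqS h h' t : (forall a b c, h a b c = h' a b c) -> S h t = S h' t.
  by move=> E; do 3!apply: eq_bigr => ? _; rewrite E.
have flip := zinbiel_form_flip hB.
have block i i' : \sum_j \sum_l term i j i' l =
    S p (vd (x i) (x i') *t y i *t y i') + S q (da (x i) (x i') *t y i *t y i')
    + (S q (x i *t x i' *t vd (y i) (y i')) + S r (x i *t x i' *t da (y i) (y i')))
    + (S r (x i' *t vd (x i) (y i') *t y i) + S p (x i' *t da (x i) (y i') *t y i)).
  transitivity (\sum_j \sum_l
      ((vd (x i) (x i') *t dm (e j) (e l)) *t v (i, j) *t v (i', l)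
       + (da (x i) (x i') *t dm (e l) (e j)) *t v (i, j) *t v (i', l)
       + (u (i, j) *t u (i', l) *t (vd (y i) (y i') *t dm (f j) (f l))
          + u (i, j) *t u (i', l) *t (da (y i) (y i') *t dm (f l) (f j)))
       - (u (i', l) *t (vd (x i) (y i') *t dm (e j) (f l)) *t v (i, j)
          + u (i', l) *t (da (x i) (y i') *t dm (f l) (e j)) *t v (i, j)))).
    apply: eq_bigr => j _; apply: eq_bigr => l _.
    by rewrite /term /m !ind_mul_tens !(linearDl, linearDr).
  under eq_bigr do rewrite sumrB !big_split /=.
  rewrite sumrB !big_split /= opprD.
  (* The product on the tensors contributes both [dm] and its opposite, so each leg lemma is used
     twice. Flips bring the coefficients to [p], [q], [r], and the sign of [legs2] cancels the minus
     of the third term. *)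
  congr (_ + _ + (_ + _) + (_ + _)).
  - exact: (legs1 (vd (x i) (x i')) (y i) (y i') dm).
  - exact: (legs1 (da (x i) (x i')) (y i) (y i') (fun a b => dm b a)).
  - rewrite -(eqS _ _ _ (fun a b c => flip (e a) (e b) (e c))).
    exact: (legs3 (x i) (x i') (vd (y i) (y i')) dmB).
  - exact: (legs3 (x i) (x i') (da (y i) (y i')) mdB).
  - rewrite -(eqS _ _ _ (fun a b c => flip (e c) (e a) (e b))); apply: oppr_inj.
    rewrite opprK; exact: (legs2 (x i') (vd (x i) (y i')) (y i) dmB).
  - rewrite -(eqS _ _ _ (fun a b c => flip (e a) (e c) (e b))); apply: oppr_inj.
    rewrite opprK; exact: (legs2 (x i') (da (x i) (y i')) (y i) mdB).
rewrite (eq_bigr _ (fun i _ => eq_bigr _ (fun i' _ => block i i'))).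
under eq_bigr do rewrite !big_split /=.
rewrite !big_split /= !S_sum.
have SD h t t' : S h t + S h t' = S h (t + t').
  have trD a b c : tr a b c (t + t') = tr a b c t + tr a b c t' by exact: linearD.
  rewrite /S -big_split; apply: eq_bigr => a _; rewrite -big_split.
  apply: eq_bigr => b _; rewrite -big_split; apply: eq_bigr => c _.
  by rewrite trD scalerDr.
have S3 t : S p t + S q t + S r t = 0.
  rewrite /S -!big_split; apply: big1 => a _; rewrite -!big_split.
  apply: big1 => b _; rewrite -!big_split; apply: big1 => c _ /=.
  rewrite -!scalerDl (_ : _ + _ = 0) ?scale0r //.
  by rewrite /p /q /r (flip (e c)) addrAC; apply: zinbiel_form_cyclic.
(* Grouping by coefficient applies [S p], [S q] and [S r] to three sums in [D]. The diassociative
   equation and its rotation make these three sums equal, and [p + q + r] vanishes by the cyclic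
   identity. *)
rewrite [LHS](AC (2*2*2) ((1*6)*(2*3)*(4*5))) /= !SD.
by rewrite (diass_YBE_sums Y) -(diass_YBE_rot sym Y) S3.
Qed.

Variable nu : B -> tensor B B.
Hypothesis hnu : nu_spec dm om nu.

Lemma nu_expand b :
  nu b = \sum_a \sum_c om b (dm (e a) (e c)) *: (f a *t f c).
Proof.
(* [ev] rebuilds a tensor from its pairings with the [e a *t e c]. It is the identity on pure
   tensors by [expand], hence everywhere by linearity, and on [nu b] the pairings are given by
   [nu_spec]. *)
pose ev (s : tensor B B) := \sum_a \sum_c om2 om s (e a *t e c) *: (f a *t f c).
have om2_tens a b' c d : om2 om (a *t b') (c *t d) = om a c * om b' d.
  have [oml omr] := om_bilinear hB.
  have inner a1 b1 : bilinear_map (fun a2 b2 : B => om a1 a2 * om b1 b2 : k^o).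
    split=> [w|w] z s t; rewrite omr; first by rewrite mulrDl -mulrA.
    by rewrite mulrDr mulrCA.
  rewrite /om2 tlift_tens ?tlift_tens //.
  split=> [w|w] z s t; apply: tlift_param_linear => g h; rewrite oml.
    by rewrite mulrDl -mulrA.
  by rewrite mulrDr mulrCA.
transitivity (ev (nu b)); last first.
  by apply: eq_bigr => a _; apply: eq_bigr => c _; rewrite hnu.
have ev_lin : linear ev.
  move=> z s t; rewrite /ev scaler_sumr -big_split; apply: eq_bigr => a _.
  rewrite scaler_sumr -big_split; apply: eq_bigr => c _ /=.
  rewrite scalerA -scalerDl; congr (_ *: _).
  exact: (tlift_linear (W := k^o) _ z s t).
apply: (tens_ext (f := id)) (nu b) => // a c.
rewrite {1}(expand a) {1}(expand c) linear_sumlz; apply: eq_bigr => i _.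
rewrite linear_sumr; apply: eq_bigr => j _ /=.
by rewrite om2_tens linearZl_LR linearZr_LR /= scalerA.
Qed.

Section DeltaTerms.
Variables (d1 d2 : D) (p : B -> B).
Hypothesis lp : linear p.
Let U (h : 'I_n -> 'I_n -> k) :=
  \sum_a \sum_c h a c *: ((d1 *t f a) *t (d2 *t f c)).

Let PsiB : bilinear_map (fun a c : B => (d1 *t a) *t (d2 *t c)).
Proof. by split=> [w|w] z s t; rewrite !(linearPl, linearPr). Qed.

Lemma legs_r : \sum_j (d1 *t e j) *t (d2 *t p (f j)) =
  U (fun a c => - om (p (e a)) (e c)).
Proof.
rewrite (dual_bases_skew_r om_skew expand PsiB) // /U -sumrN.
by apply: eq_bigr => a _; rewrite -sumrN; apply: eq_bigr => c _; rewrite scaleNr.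
Qed.

Lemma legs_l : \sum_j (d1 *t p (e j)) *t (d2 *t f j) =
  U (fun a c => om (p (e c)) (e a)).
Proof. by rewrite (dual_bases_expand_l expand PsiB). Qed.

End DeltaTerms.

Lemma bullet_nu (d1 d2 : D) b : bullet (d1 *t d2) (nu b) =
  \sum_a \sum_c om b (dm (e a) (e c)) *: ((d1 *t f a) *t (d2 *t f c)).
Proof.
rewrite nu_expand linear_sumr; apply: eq_bigr => a _; rewrite linear_sumr.
by apply: eq_bigr => c _; rewrite linearZr_LR /= bullet_tens.
Qed.

Lemma bullet_tau_nu (d1 d2 : D) b : bullet (d1 *t d2) (tau (nu b)) =
  \sum_a \sum_c om b (dm (e c) (e a)) *: ((d1 *t f a) *t (d2 *t f c)).
Proof.
rewrite nu_expand exchange_big linear_sum linear_sumr; apply: eq_bigr => a _ /=.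
rewrite linear_sum linear_sumr; apply: eq_bigr => c _.
by rewrite linearZ /= tau_tens linearZr_LR /= bullet_tens.
Qed.

(** Over the [f a], [f c] every term on the left has a coefficient in the span of those of [nu b]
    and of [tau (nu b)]. Collecting the multiples of the former yields [th_vd_of], and of the latter
    [th_da_of]. *)
Lemma Delta_of_ind_tensor d b :
  Delta_of m (\sum_p u p *t v p) (d *t b) =
  bullet (th_vd_of da vd (\sum_i x i *t y i) d) (nu b)
  + bullet (th_da_of da vd (\sum_i x i *t y i) d) (tau (nu b)).
Proof.
have [dml dmr] : bilinear_map dm.
  exact: zinbiel_bilinear (quadratic_zinbiel_alg hB).
pose U (h : 'I_n -> 'I_n -> k) (d1 d2 : D) :=
  \sum_a \sum_c h a c *: ((d1 *t f a) *t (d2 *t f c)).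
(* By [nu_expand], [N] and [N'] are the coefficients of [nu b] and [tau (nu b)] on [f a *t f c]. *)
pose N a c := om b (dm (e a) (e c)).
pose N' a c := om b (dm (e c) (e a)).
have eqU h h' d1 d2 : (forall a c, h a c = h' a c) -> U h d1 d2 = U h' d1 d2.
  by move=> E; do 2!apply: eq_bigr => ? _; rewrite E.
have UD h h' d1 d2 : U h d1 d2 + U h' d1 d2 = U (fun a c => h a c + h' a c) d1 d2.
  rewrite /U -big_split; apply: eq_bigr => a _; rewrite -big_split.
  by apply: eq_bigr => c _; rewrite scalerDl.
have UN h d1 d2 : - U h d1 d2 = U (fun a c => - h a c) d1 d2.
  rewrite /U -sumrN; apply: eq_bigr => a _; rewrite -sumrN.
  by apply: eq_bigr => c _; rewrite scaleNr.
rewrite Delta_ofE.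
have -> : \sum_p (u p *t m (d *t b) (v p) - m (u p) (d *t b) *t v p) =
  \sum_i (\sum_j ((x i *t e j) *t (vd d (y i) *t dm b (f j)))
          + \sum_j ((x i *t e j) *t (da d (y i) *t dm (f j) b))
          - (\sum_j ((vd (x i) d *t dm (e j) b) *t (y i *t f j))
             + \sum_j ((da (x i) d *t dm b (e j)) *t (y i *t f j)))).
  rewrite -(pair_bigA _ (fun i j => u (i, j) *t m (d *t b) (v (i, j))
    - m (u (i, j)) (d *t b) *t v (i, j))); apply: eq_bigr => i _ /=.
  rewrite -!big_split -sumrB; apply: eq_bigr => j _ /=.
  by rewrite /m !ind_mul_tens linearDl linearDr.
have subl (p q : {bilinear D -> D -> D}) : linear (rmul p d \- rmul q d).
  by move=> z s t; rewrite /= /rmul !linearPl scalerBr addrACA -opprD.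
have subr (p q : {bilinear D -> D -> D}) : linear (lmul p d \- lmul q d).
  by move=> z s t; rewrite /= /lmul !linearPr scalerBr addrACA -opprD.
rewrite /th_vd_of /th_da_of (tmap_l_sum _ _ _ (subl vd da)).
rewrite (tmap_l_sum _ _ _ (rmul_linear vd d)) (tmap_r_sum _ _ _ (subr vd da)).
rewrite (tmap_r_sum _ _ _ (lmul_linear da d)).
rewrite -[X in bullet (- X) _]big_split -[X in bullet X (nu b)]sumrN.
rewrite -[X in bullet X (tau _)]sumrB 2!linear_sumlz -big_split.
apply: eq_bigr => i _.
rewrite /= /rmul /lmul !(linearNl, linearDl, linearBl, linearBr) /=.
rewrite !bullet_nu !bullet_tau_nu.
have flip := zinbiel_form_flip hB.
(* The cyclic identity with [b] in the middle: this value of the form is the source of every term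
   that contributes to both [N] and [N']. *)
have form a c : om (dm (e a) b) (e c) = N a c + N' a c.
  have /eqP := zinbiel_form_cyclic hB (e a) b (e c).
  by rewrite /N /N' !(om_skew b) -opprD -addrA addr_eq0 => /eqP ->.
have L1 : \sum_j (x i *t e j) *t (vd d (y i) *t dm b (f j)) =
    U N' (x i) (vd d (y i)).
  rewrite (legs_r _ _ (dmr b)); apply: eqU => a c.
  by rewrite flip /N' (om_skew b).
have L2 : \sum_j (x i *t e j) *t (da d (y i) *t dm (f j) b) =
    - U N (x i) (da d (y i)) - U N' (x i) (da d (y i)).
  rewrite (legs_r _ _ (dml b)) !UN UD; apply: eqU => a c.
  by rewrite form opprD.
have L3 : \sum_j (vd (x i) d *t dm (e j) b) *t (y i *t f j) =
    U N (vd (x i) d) (y i) + U N' (vd (x i) d) (y i).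
  rewrite (legs_l _ _ (fun c => dm c b)) UD; apply: eqU => a c.
  by rewrite flip form.
have L4 : \sum_j (da (x i) d *t dm b (e j)) *t (y i *t f j) =
    - U N (da (x i) d) (y i).
  rewrite (legs_l _ _ (dm b)) UN; apply: eqU => a c.
  by rewrite flip /N (om_skew b) opprK.
rewrite L1 L2 L3 L4 /U !opprD !opprK !addrA.
by rewrite [RHS](ACl (4*3*5*1*6*2)).
Qed.

(** The map [nu] is given only through its pairings; linearity is read off from the explicit
    expansion. *)
Lemma nu_linear : linear nu.
Proof.
have [oml _] := om_bilinear hB.
move=> z s t; rewrite !nu_expand scaler_sumr -big_split; apply: eq_bigr => a _.
rewrite scaler_sumr -big_split; apply: eq_bigr => c _ /=.
by rewrite oml scalerDl scalerA.
Qed.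

Lemma ind_Delta_tens (th_da th_vd : D -> tensor D D) d b :
  linear th_da -> linear th_vd ->
  ind_Delta th_da th_vd nu (d *t b) =
  bullet (th_vd d) (nu b) + bullet (th_da d) (tau (nu b)).
Proof.
move=> lda lvd; rewrite /ind_Delta tlift_tens //.
split=> [c|c] z s t.
  by rewrite lda lvd !linearPl /= addrACA -scalerDr.
by rewrite nu_linear linearP /= !linearPr /= addrACA -scalerDr.
Qed.

End InducedTriangular.

(** * Transport along pointwise equality, and assembly of the theorem *)

(** The two coproducts are known to agree only pointwise, so the axioms are transferred one by one,
    with [eq_tmap] handling coassociativity. *)
Lemma asi_bialgebra_ext (k : fieldType) (A : vectType k) (m : A -> A -> A)
    (Delta Delta' : A -> tensor A A) :
  Delta =1 Delta' -> asi_bialgebra m Delta' -> asi_bialgebra m Delta.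
Proof.
move=> E [mB mA lin coassoc compat antisym]; split=> //.
- by move=> z s t; rewrite !E lin.
- move=> a; rewrite E (eq_tmap E (frefl _)) (eq_tmap (frefl _) E).
  exact: coassoc.
- by move=> a b; rewrite !E compat.
- by move=> a b; rewrite !E antisym.
Qed.

Lemma basis_span (k : fieldType) (B : vectType k) n (e : n.-tuple B) :
  basis_of fullv e ->
  forall b, exists c : 'I_n -> k, b = \sum_j c j *: tnth e j.
Proof.
move=> /span_basis span_e b; exists (fun j => coord e j b).
have /coord_span {1}-> : b \in <<e>>%VS by rewrite span_e memvf.
by apply: eq_bigr => j _; rewrite (tnth_nth 0).
Qed.

Theorem theorem3p10 (k : fieldType) (char0 : [pchar k] =i pred0)
    (D B : vectType k)
    (da vd : D -> D -> D) (th_da th_vd : D -> tensor D D)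
    (dm : B -> B -> B) (om : B -> B -> k) (nu : B -> tensor B B)
    (hD : diass_bialgebra da vd th_da th_vd)
    (hB : quadratic_zinbiel dm om)
    (hnu : nu_spec dm om nu) :
  let mul := ind_mul da vd dm in
  let Delta := ind_Delta th_da th_vd nu in
  (forall (I : finType) (x y : I -> D) (n : nat) (e f : n.-tuple B),
     let r := \sum_i x i *t y i in
     let rt := \sum_i \sum_(j < n) (x i *t tnth e j) *t (y i *t tnth f j) in
     tau r = r ->
     diass_YBE da vd x y ->
     th_da =1 th_da_of da vd r ->
     th_vd =1 th_vd_of da vd r ->
     basis_of fullv e ->
     (forall i j : 'I_n, om (tnth f i) (tnth e j) = (i == j)%:R) ->
     [/\ asi_bialgebra mul Delta,
         asi_bialgebra mul (Delta_of mul rt) &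
         Delta =1 Delta_of mul rt]) /\
  (triangular_diass da vd th_da th_vd -> triangular_asi mul Delta).
Proof.
have hA := diass_bialgebra_alg hD; have hC := diass_bialgebra_coalg hD.
have hZ := quadratic_zinbiel_alg hB.
(* The products and the form are bare functions with bilinearity as a property; packing them makes
   the results on bundled bilinear maps applicable. *)
pose da' : {bilinear D -> D -> D} :=
  HB.pack da (bilinear_isBilinear.Build _ _ _ _ _ _ da (da_bilinear hA)).
pose vd' : {bilinear D -> D -> D} :=
  HB.pack vd (bilinear_isBilinear.Build _ _ _ _ _ _ vd (vd_bilinear hA)).
pose dm' : {bilinear B -> B -> B} :=
  HB.pack dm (bilinear_isBilinear.Build _ _ _ _ _ _ dm (zinbiel_bilinear hZ)).
pose om' : {biscalar B} :=
  HB.pack om (bilinear_isBilinear.Build _ _ _ _ _ _ om (om_bilinear hB)).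
move=> mul Delta.
(* Here the tensor is a single sum over pairs of indices, the form required by [assoc_YBE] and by
   the existential in [triangular_asi]. Both halves of the theorem follow from this claim. *)
have key (I : finType) (x y : I -> D) n (e f : n.-tuple B) :
    let r := \sum_i x i *t y i in
    let u (p : I * 'I_n) := x p.1 *t tnth e p.2 in
    let v (p : I * 'I_n) := y p.1 *t tnth f p.2 in
    let rt := \sum_p u p *t v p in
    tau r = r -> diass_YBE da vd x y ->
    th_da =1 th_da_of da vd r -> th_vd =1 th_vd_of da vd r ->
    basis_of fullv e ->
    (forall i j : 'I_n, om (tnth f i) (tnth e j) = (i == j)%:R) ->
    [/\ tau rt = - rt, assoc_YBE mul u v, asi_bialgebra mul (Delta_of mul rt) &
        Delta =1 Delta_of mul rt].
  move=> r u v rt sym Y Eda Evd e_basis dual.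
  have expand := dual_basis_expand hB dual (basis_span e_basis).
  have skew : tau rt = - rt.
    exact: (ind_tensor_skew (dm := dm') (om := om') hB expand sym).
  have YBE : assoc_YBE mul u v.
    exact: (ind_assoc_YBE (da := da') (vd := vd') (dm := dm') (om := om')
              hB expand sym Y).
  have mulA : associative mul.
    exact: (ind_mul_assoc (da := da') (vd := vd') (dm := dm') hA hZ).
  split=> //.
    exact: (Delta_of_asi (m := ind_mul da' vd' dm') mulA skew YBE).
  (* Both coproducts are linear, so comparing them on pure tensors suffices. *)
  apply: tens_ext => [||d b].
  - exact: tlift_linear.
  - exact: (Delta_of_linear (ind_mul da' vd' dm')).
  rewrite /Delta (ind_Delta_tens (dm := dm') (om := om') hB expand hnu) //;
    [|exact: (th_da_linear hC)|exact: (th_vd_linear hC)].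
  rewrite Eda Evd; apply: esym.
  exact: (Delta_of_ind_tensor da' vd' (dm := dm') (om := om')
            hB expand x y hnu).
split=> [I x y n e f r rt sym Y Eda Evd e_basis dual|].
  have := key I x y n e f sym Y Eda Evd e_basis dual.
  rewrite -(pair_bigA _ (fun i j => (x i *t tnth e j) *t (y i *t tnth f j))) /=.
  by case=> _ _ asi E; split=> //; apply: asi_bialgebra_ext asi.
case=> _ [I [x [y /= [sym Y Eda Evd]]]].
(* Triangularity mentions no basis of [B], so one is chosen together with its dual. *)
have e_basis := vbasisP (@fullv k B).
have [f dual] := dual_basis_exists hB e_basis.
have [skew YBE asi E] := key I x y _ _ f sym Y Eda Evd e_basis dual.
by split; [apply: asi_bialgebra_ext asi | do 3!eexists; split; eauto].
Qed.
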